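(* Let $\mathfrak{X}$ be a compact Hausdorff space and, for each $x\in\mathfrak{X}$, let $\alpha^x=\{\alpha^x_t : t\in\mathbb{R}\}$ be a one-parameter group of $*$-automorphisms of $\mathfrak{B}(\mathcal{H})$ (that is, $\alpha^x_0=\mathrm{id}$ and $\alpha^x_{t+s}=\alpha^x_t\circ\alpha^x_s$ for all $s,t\in\mathbb{R}$), such that for every $A\in\mathfrak{B}(\mathcal{H})$ the map $\mathfrak{X}\times\mathbb{R}\to\mathfrak{B}(\mathcal{H})$, $(x,t)\mapsto\alpha^x_t(A)$, is $\sigma$-weakly continuous. Then there exists a family of unitaries $\{U^x_t : t\in\mathbb{R},\, x\in\mathfrak{X}\}$ in $\mathfrak{B}(\mathcal{H})$ such that: (1) the map $(x,t)\mapsto U^x_t$ is strongly continuous on $\mathfrak{X}\times\mathbb{R}$; (2) for each $x\in\mathfrak{X}$, $\{U^x_t : t\in\mathbb{R}\}$ is a unitary group, i.e. $U^x_0=1$ and $U^x_{t+s}=U^x_tU^x_s$ for all $s,t\in\mathbb{R}$; (3) $\alpha^x_t(A)=U^x_tA(U^x_t)^*$ for all $A\in\mathfrak{B}(\mathcal{H})$, $t\in\mathbb{R}$ and $x\in\mathfrak{X}$. In particular, the family $\{\alpha^x : x\in\mathfrak{X}\}$ is trivializable.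
   Context: $\mathcal{H}$ is a separable infinite-dimensional Hilbert space, $\mathfrak{B}(\mathcal{H})$ is the $*$-algebra of bounded operators on it, and $\mathcal{U}(\mathcal{H})$ is its unitary group with the strong operator topology. $\mathbb{R}_+=[0,\infty)$. An $E_0$-semigroup acting on $\mathfrak{B}(\mathcal{H})$ is a point-$\sigma$-weakly continuous one-parameter semigroup $\beta=\{\beta_t\}_{t\ge 0}$ of unital $*$-endomorphisms of $\mathfrak{B}(\mathcal{H})$ with $\beta_0=\mathrm{id}$. A $\beta$-cocycle is a strongly continuous family of unitaries $\{U_t\}_{t\ge0}$ in $\mathcal{U}(\mathcal{H})$ with $U_0=1$ and $U_{t+s}=U_t\beta_t(U_s)$ for all $s,t\ge 0$. The space $C(\mathbb{R}_+,\mathcal{U}(\mathcal{H}))$ carries the compact-open topology. Trivializable: a family $\{\alpha^x\}_{x\in\mathfrak X}$ of $E_0$-semigroups that are all cocycle equivalent to $\beta$ is trivializable if it is equivalent to the constant family $\beta$, i.e. there are $\beta$-cocycles $U^x$ ($x\in\mathfrak{X}$) such that $x\mapsto U^x$ is continuous as a map $\mathfrak{X}\to C(\mathbb{R}_+,\mathcal{U}(\mathcal{H}))$ and $\alpha^x_t(A)=U^x_t\beta_t(A)(U^x_t)^*$ for all $t\ge0$, $x\in\mathfrak{X}$, $A\in\mathfrak{B}(\mathcal{H})$. For a family of automorphism groups, each $\alpha^x$ is regarded as an $E_0$-semigroup by restricting to $t\ge0$, and the reference semigroup $\beta$ is any $E_0$-semigroup consisting of automorphisms of $\mathfrak{B}(\mathcal{H})$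 (for instance $\beta_t=\mathrm{id}$ for all $t$). *)

(* Defs.v *)
From HB Require Import structures.
From mathcomp Require Import all_boot all_order all_algebra.
From mathcomp Require Import all_classical all_reals all_analysis.
From mathcomp Require Import complex.

Set Implicit Arguments.
Unset Strict Implicit.
Unset Printing Implicit Defensive.

Import Order.TTheory GRing.Theory Num.Theory.
Import numFieldNormedType.Exports.

Local Open Scope classical_set_scope.
Local Open Scope ring_scope.
Local Open Scope complex_scope.

(* Inner products are linear in the first variable; [{dot H for Num.conj}] is
   MathComp's type of positive definite Hermitian forms. The norm of [H] takes
   its (real) values in [R[i]]. *)
HB.mixin Record CompleteNormedModule_isHilbert (R : realType) H
    of CompleteNormedModule R[i] H := {
  inner : {dot H for @Num.conj R[i]};
  sqr_norm_inner : forall x : H, `|x| ^+ 2 = inner x x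
}.

#[short(type="hilbertType")]
HB.structure Definition Hilbert (R : realType) :=
  {H of CompleteNormedModule R[i] H & CompleteNormedModule_isHilbert R H}.

Definition separable (T : topologicalType) :=
  exists2 D : set T, countable D & dense D.

Definition infinite_dimensional (K : fieldType) (V : lmodType K) :=
  forall s : seq V, exists v : V,
    forall c : 'I_(size s) -> K, v <> \sum_i c i *: s`_i.

Record bop (R : realType) (H : hilbertType R) := Bop {
  bop_fun :> H -> H;
  bop_linear : linear bop_fun;
  bop_bounded : exists M : R[i], forall x, `|bop_fun x| <= M * `|x|
}.

Section bounded_operators.
Context {R : realType} {H : hilbertType R}.
Implicit Types A B C : bop H.

HB.instance Definition _ A :=
  GRing.isLinear.Build R[i] H H *:%R A (bop_linear A).

HB.instance Definition _ := gen_eqMixin (bop H).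
HB.instance Definition _ := gen_choiceMixin (bop H).

Lemma bopP A B : (forall x, A x = B x) -> A = B.
Proof.
case: A => f fl fb; case: B => g gl gb /= /funext fg.
by case: _ / fg in gl gb *; congr Bop; exact: Prop_irrelevance.
Qed.

Fact zero_linear : linear (fun _ : H => 0 : H).
Proof. by move=> a x y; rewrite scaler0 addr0. Qed.
Fact zero_bounded : exists M : R[i], forall x : H, `|0 : H| <= M * `|x|.
Proof. by exists 0 => x; rewrite normr0 mul0r. Qed.
Definition bop_zero : bop H := Bop zero_linear zero_bounded.

Fact one_linear : linear (@idfun H). Proof. by []. Qed.
Fact one_bounded : exists M : R[i], forall x : H, `|x| <= M * `|x|.
Proof. by exists 1 => x; rewrite mul1r. Qed.
Definition bop_one : bop H := Bop one_linear one_bounded.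

Fact opp_linear A : linear (fun x => - A x).
Proof. by move=> a x y; rewrite linearP opprD scalerN. Qed.
Fact opp_bounded A : exists M : R[i], forall x : H, `|- A x| <= M * `|x|.
Proof.
by have [M AM] := bop_bounded A; exists M => x; rewrite normrN.
Qed.
Definition bop_opp A : bop H := Bop (opp_linear A) (opp_bounded A).

Fact add_linear A B : linear (fun x => A x + B x).
Proof. by move=> a x y; rewrite !linearP scalerDr addrACA. Qed.
Fact add_bounded A B : exists M : R[i], forall x : H, `|A x + B x| <= M * `|x|.
Proof.
have [M AM] := bop_bounded A; have [N BN] := bop_bounded B.
by exists (M + N) => x; rewrite mulrDl (le_trans (ler_normD _ _))// lerD.
Qed.
Definition bop_add A B : bop H := Bop (add_linear A B) (add_bounded A B).

Fact scale_linear (c : R[i]) A : linear (fun x => c *: A x).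
Proof. by move=> a x y; rewrite linearP scalerDr !scalerA mulrC. Qed.
Fact scale_bounded (c : R[i]) A :
  exists M : R[i], forall x : H, `|c *: A x| <= M * `|x|.
Proof.
have [M AM] := bop_bounded A.
by exists (`|c| * M) => x; rewrite normrZ -mulrA ler_wpM2l.
Qed.
Definition bop_scale c A : bop H := Bop (scale_linear c A) (scale_bounded c A).

Fact comp_linear A B : linear (A \o B).
Proof. by move=> a x y /=; rewrite !linearP. Qed.
Fact comp_bounded A B : exists M : R[i], forall x : H, `|A (B x)| <= M * `|x|.
Proof.
have [M AM] := bop_bounded A; have [N BN] := bop_bounded B.
exists (`|M| * N) => x; have [->|Bx0] := eqVneq (B x) 0.
  rewrite linear0 normr0 -mulrA mulr_ge0//.
  by rewrite (le_trans _ (BN x)).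
have M0 : 0 <= M.
  by rewrite -(pmulr_lge0 (x := `|B x|)) ?normr_gt0// (le_trans _ (AM (B x))).
by rewrite (le_trans (AM _))// ger0_norm// -mulrA ler_wpM2l.
Qed.
Definition bop_comp A B : bop H := Bop (comp_linear A B) (comp_bounded A B).

Fact bop_addA : associative bop_add.
Proof. by move=> A B C; apply: bopP => x /=; rewrite addrA. Qed.
Fact bop_addC : commutative bop_add.
Proof. by move=> A B; apply: bopP => x /=; rewrite addrC. Qed.
Fact bop_add0 : left_id bop_zero bop_add.
Proof. by move=> A; apply: bopP => x /=; rewrite add0r. Qed.
Fact bop_addN : left_inverse bop_zero bop_opp bop_add.
Proof. by move=> A; apply: bopP => x /=; rewrite addNr. Qed.
HB.instance Definition _ :=
  GRing.isZmodule.Build (bop H) bop_addA bop_addC bop_add0 bop_addN.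

Fact bop_compA : associative bop_comp.
Proof. by move=> A B C; apply: bopP. Qed.
Fact bop_comp1l : left_id bop_one bop_comp.
Proof. by move=> A; apply: bopP. Qed.
Fact bop_comp1r : right_id bop_one bop_comp.
Proof. by move=> A; apply: bopP. Qed.
Fact bop_compDl : left_distributive bop_comp +%R.
Proof. by move=> A B C; apply: bopP. Qed.
Fact bop_compDr : right_distributive bop_comp +%R.
Proof. by move=> A B C; apply: bopP => x /=; rewrite linearD. Qed.
HB.instance Definition _ := GRing.Zmodule_isPzRing.Build (bop H)
  bop_compA bop_comp1l bop_comp1r bop_compDl bop_compDr.

Fact bop_scaleA (a b : R[i]) A :
  bop_scale a (bop_scale b A) = bop_scale (a * b) A.
Proof. by apply: bopP => x /=; rewrite scalerA. Qed.
Fact bop_scale1 : left_id 1 bop_scale.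
Proof. by move=> A; apply: bopP => x /=; rewrite scale1r. Qed.
Fact bop_scaleDr : right_distributive bop_scale +%R.
Proof. by move=> a A B; apply: bopP => x /=; rewrite scalerDr. Qed.
Fact bop_scaleDl A : {morph bop_scale^~ A : a b / a + b}.
Proof. by move=> a b; apply: bopP => x /=; rewrite scalerDl. Qed.
HB.instance Definition _ := GRing.Zmodule_isLmodule.Build R[i] (bop H)
  bop_scaleA bop_scale1 bop_scaleDr bop_scaleDl.

(* By the Riesz representation theorem the set below is a singleton, so the
   default value of [xget] is never taken. *)
Definition adjoint A : bop H :=
  xget 0 [set B : bop H | forall x y, inner (A x) y = inner x (B y)].

Definition unitary A := adjoint A * A = 1 /\ A * adjoint A = 1.

Definition star_endomorphism (f : bop H -> bop H) :=
  [/\ linear f, monoid_morphism f & forall A, f (adjoint A) = adjoint (f A)].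

Definition star_automorphism (f : bop H -> bop H) :=
  star_endomorphism f /\ bijective f.

End bounded_operators.

Notation "A ^†" := (adjoint A) (at level 2, format "A ^†") : ring_scope.

Section operator_topologies.
Context {R : realType} (H : hilbertType R).

Definition strong_bop : Type :=
  initial_topology (fun A : bop H => (A : H -> H) : {ptws H -> H}).
HB.instance Definition _ := Topological.on strong_bop.

(* [R[i]^o] is [R[i]] with its metric topology. *)
Definition square_summable : set (nat -> H) :=
  [set xi | cvgn (series (fun n => `|xi n| ^+ 2) : R[i]^o ^nat)].

Definition normal_functional (p : square_summable * square_summable)
    (A : bop H) : R[i]^o :=
  limn (series (fun n => inner (A (val p.1 n)) (val p.2 n)) : R[i]^o ^nat).

Definition sigma_weak_bop : Type :=
  initial_topology (fun A : bop H => normal_functional ^~ A :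
    {ptws (square_summable * square_summable)%type -> R[i]^o}).
HB.instance Definition _ := Topological.on sigma_weak_bop.

Definition unitary_group : set strong_bop := [set A | unitary (A : bop H)].

Definition bop_of_unitary (U : unitary_group) : bop H := val U.

End operator_topologies.

Arguments square_summable {R} H.
Arguments unitary_group {R} H.
Arguments normal_functional {R H} p A.
Arguments bop_of_unitary {R H} U.

Definition Rplus (R : realType) : set R := [set t | 0 <= t].
Arguments Rplus R : clear implicits.

Section Rplus.
Context {R : realType}.

Fact Rplus_zero_subproof : (0 : R) \in Rplus R.
Proof. by rewrite inE /Rplus /=. Qed.
Definition Rplus_zero : Rplus R := exist _ 0 Rplus_zero_subproof.

Fact Rplus_add_subproof (s t : Rplus R) : val s + val t \in Rplus R.
Proof.
by rewrite inE; apply: addr_ge0; [exact: set_valP s|exact: set_valP t].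
Qed.
Definition Rplus_add (s t : Rplus R) : Rplus R :=
  exist _ (val s + val t) (Rplus_add_subproof s t).

End Rplus.

Section semigroups.
Context {R : realType} {H : hilbertType R}.
Implicit Types b a : Rplus R -> bop H -> bop H.

Definition E0_semigroup b :=
  [/\ forall t, star_endomorphism (b t),
      b Rplus_zero = id,
      forall t s, b (Rplus_add t s) = b t \o b s &
      forall A, continuous (fun t => b t A : sigma_weak_bop H)].

Definition unitary_path := continuousType (Rplus R) (unitary_group H).

Definition unitary_path_space : Type := initial_topology
  (fun U : unitary_path =>
     (U : Rplus R -> unitary_group H) :
       {compact-open, Rplus R -> unitary_group H}).
HB.instance Definition _ := Topological.on unitary_path_space.

Definition cocycle b (U : unitary_path) :=
  bop_of_unitary (U Rplus_zero) = 1 /\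
  forall t s, bop_of_unitary (U (Rplus_add t s)) =
    bop_of_unitary (U t) * b t (bop_of_unitary (U s)).

(* Cocycle equivalence of each [a x] to [b] is the last conjunct at [x]. *)
Definition trivializable (X : topologicalType)
    (a : X -> Rplus R -> bop H -> bop H) b :=
  (forall x, E0_semigroup (a x)) /\
  exists U : X -> unitary_path,
    [/\ forall x, cocycle b (U x),
        continuous (fun x => U x : unitary_path_space) &
        forall x t A, a x t A =
          bop_of_unitary (U x t) * b t A * (bop_of_unitary (U x t))^†].

Definition star_automorphism_group (a : R -> bop H -> bop H) :=
  [/\ forall t, star_automorphism (a t),
      a 0 = id &
      forall t s, a (t + s) = a t \o a s].

End semigroups.

(* Main.v *)
Require Import Defs.
From HB Require Import structures.
From mathcomp Require Import all_boot all_order all_algebra.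
From mathcomp Require Import all_classical all_reals all_analysis.
From mathcomp Require Import complex ring lra.

(* Fix a unit vector e. An automorphism f with <f(|e><e|) e, e> > 0 is implemented
   by the unitary V x = f(|x><e|) e / sqrt <f(|e><e|) e, e>, a formula that is
   weakly, hence strongly, continuous in f. By compactness of X it applies to
   alpha^x_t for all x at once as soon as 0 <= t is small, and then
   V_s V_t = exp(i b(s, t)) V_(s+t) with b real, continuous and an additive
   2-cocycle. Integrating the cocycle identity gives, continuously in x, a g with
   b(s, t) = g(s) + g(t) - g(s + t), so that exp(-i g(t)) V_t is a local semigroup.
   It extends to all t >= 0 as (U_(t/m))^m with m large, and to t < 0 by taking
   adjoints. Only t >= 0 matters up to the last step, so the construction also
   yields implementers W_t of the reference semigroup, and U_t W_t^* is the
   required cocycle. *)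

Import Order.TTheory GRing.Theory Num.Theory.
Import numFieldNormedType.Exports.

Set Implicit Arguments.
Unset Strict Implicit.
Unset Printing Implicit Defensive.

Local Open Scope classical_set_scope.
Local Open Scope ring_scope.

Local Notation Re := complex.Re.
Local Notation Im := complex.Im.

(** * Unitary operators and rank one operators *)

Section inner_product.
Context {R : realType} {H : hilbertType R}.
Implicit Types (x y z : H) (a : R[i]) (A B V : bop H).

Lemma innerDl x y z : inner (x + y) z = inner x z + inner y z.
Proof. exact: linearDl. Qed.

Lemma innerZl a x y : inner (a *: x) y = a * inner x y.
Proof. exact: linearZl_LR. Qed.

Lemma innerZr a x y : inner x (a *: y) = Num.conj a * inner x y.
Proof. exact: linearZr_LR. Qed.

Lemma innerBl x y z : inner (x - y) z = inner x z - inner y z.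
Proof. exact: linearBl. Qed.

Lemma innerBr x y z : inner x (y - z) = inner x y - inner x z.
Proof. exact: linearBr. Qed.

Lemma inner0l x : inner 0 x = 0. Proof. exact: linear0l. Qed.
Lemma inner0r x : inner x 0 = 0. Proof. exact: linear0r. Qed.

Lemma inner_conj x y : Num.conj (inner x y) = inner y x.
Proof. by rewrite [RHS]hermC mul1r. Qed.

Lemma inner_eq0 x : inner x x = 0 -> x = 0.
Proof. by move=> /eqP; rewrite dnorm_eq0 => /eqP. Qed.

Lemma inner_inj x y : (forall z, inner x z = inner y z) -> x = y.
Proof.
move=> xy; apply/eqP; rewrite -subr_eq0; apply/eqP/inner_eq0.
by rewrite innerBl xy subrr.
Qed.

(** Cauchy-Schwarz: [a *: y] below is the orthogonal projection of [x] on [y], and the square norm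
    of [x - a *: y] is nonnegative. *)
Lemma inner_bound x y : `|inner x y| <= `|x| * `|y|.
Proof.
have [->|y0] := eqVneq y 0; first by rewrite inner0r !normr0 mulr0.
rewrite -(@ler_pXn2r _ 2)// ?nnegrE ?mulr_ge0// exprMn !sqr_norm_inner.
have yy0 : 0 < inner y y by rewrite dnorm_gt0.
pose a := inner x y / inner y y.
have : 0 <= inner (x - a *: y) (x - a *: y) by apply: dnorm_ge0.
rewrite innerBl innerZl !innerBr !innerZr.
have -> : inner y x - Num.conj a * inner y y = 0.
  rewrite /a rmorphM fmorphV/= !inner_conj divfK ?subrr//.
  by rewrite gt_eqF.
rewrite mulr0 subr0 subr_ge0 /a rmorphM fmorphV/= !inner_conj -ler_pdivrMr//.
by rewrite normCK inner_conj mulrAC (mulrC (inner y x)).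
Qed.

Lemma bopD A x y : A (x + y) = A x + A y. Proof. exact: linearD. Qed.
Lemma bopZ A a x : A (a *: x) = a *: A x. Proof. exact: linearZ. Qed.
Lemma bopB A x y : A (x - y) = A x - A y. Proof. exact: linearB. Qed.

Lemma adjointE A B : (forall x y, inner (A x) y = inner x (B y)) -> A^† = B.
Proof.
move=> AB; apply: xget_unique => // C AC; apply: bopP => x.
apply: inner_inj => z; rewrite -[LHS]inner_conj -[RHS]inner_conj.
by rewrite -AB -AC.
Qed.

(** [adjoint] is chosen by [xget], so without the Riesz theorem its default value 0 has to be
    carried along as an alternative. *)
Lemma adjoint_spec_or0 A :
  (forall x y, inner (A x) y = inner x (A^† y)) \/ A^† = 0.
Proof.
rewrite /adjoint; case: xgetP => [B _ AB|_]; [by left|by right].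
Qed.

(** If the default value were taken, [A^† * A = 1] would read [0 = 1]; then [H] is trivial and both
    sides vanish. *)
Lemma unitary_adjoint A : unitary A ->
  forall x y, inner (A x) y = inner x (A^† y).
Proof.
move=> [AA _]; have [//|A0] := adjoint_spec_or0 A.
have H0 x : x = 0.
  have /(congr1 (fun B : bop H => B x)) : (0 : bop H) = 1.
    by rewrite -AA A0 mul0r.
  by [].
by move=> x y; rewrite (H0 y) (H0 (A^† 0)) !inner0r.
Qed.

Lemma unitaryKl A : unitary A -> forall x, A^† (A x) = x.
Proof. by case=> AA _ x; rewrite -[RHS]/((1 : bop H) x) -AA. Qed.

Lemma unitaryKr A : unitary A -> forall x, A (A^† x) = x.
Proof. by case=> _ AA x; rewrite -[RHS]/((1 : bop H) x) -AA. Qed.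

Lemma unitary_inner A : unitary A -> forall x y, inner (A x) (A y) = inner x y.
Proof. by move=> uA x y; rewrite unitary_adjoint// unitaryKl. Qed.

Lemma inner_preserving_norm (f : H -> H) :
  (forall x, inner (f x) (f x) = inner x x) -> forall x, `|f x| = `|x|.
Proof.
move=> fi x; apply/eqP; rewrite -(@eqrXn2 _ 2)//.
by rewrite !sqr_norm_inner fi.
Qed.

Lemma unitary_norm A : unitary A -> forall x, `|A x| = `|x|.
Proof.
by move=> uA; apply: inner_preserving_norm => x; exact: unitary_inner.
Qed.

(** The inverse map is linear and isometric and satisfies the adjoint identity, so the adjoint is
    exhibited explicitly. *)
Lemma surjective_isometry_unitary A :
  (forall x y, inner (A x) (A y) = inner x y) -> (forall y, exists x, A x = y) ->
  unitary A.
Proof.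
move=> Ai /choice[W AW].
have An := inner_preserving_norm (fun x => Ai x x).
have inj x y : A x = A y -> x = y.
  move=> Axy; apply/eqP; rewrite -subr_eq0 -normr_eq0 -An.
  by rewrite bopB Axy subrr normr0.
have Wl : linear W.
  move=> a x y; apply: inj; by rewrite bopD bopZ !AW.
have Wb : exists M : R[i], forall x, `|W x| <= M * `|x|.
  by exists 1 => x; rewrite mul1r -An AW.
have AE : A^† = Bop Wl Wb by apply: adjointE => x y; rewrite -[in RHS]Ai AW.
by split; rewrite AE; apply: bopP => x; [apply: inj|]; exact: AW.
Qed.

Lemma unitary_adjointK A : unitary A -> A^†^† = A.
Proof.
move=> uA; apply: adjointE => x y.
by rewrite -[LHS]inner_conj -unitary_adjoint// inner_conj.
Qed.

Lemma unitary_adj A : unitary A -> unitary A^†.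
Proof.
by move=> uA; split; rewrite unitary_adjointK//; case: uA.
Qed.

Lemma unitary1 : unitary (1 : bop H).
Proof.
by apply: surjective_isometry_unitary => // y; exists y.
Qed.

Lemma unitaryM A B : unitary A -> unitary B -> unitary (A * B).
Proof.
move=> uA uB; apply: surjective_isometry_unitary => [x y|y].
  by rewrite -[RHS](unitary_inner uB) -[RHS](unitary_inner uA).
exists (B^† (A^† y)).
by rewrite -[LHS]/(A (B _)) !unitaryKr.
Qed.

Lemma adjointM A B : unitary A -> unitary B -> (A * B)^† = B^† * A^†.
Proof.
move=> uA uB; apply: adjointE => x y.
by rewrite -[LHS]/(inner (A (B x)) y) !unitary_adjoint.
Qed.

Lemma unitaryZ a A : `|a| = 1 -> unitary A -> unitary (a *: A).
Proof.
move=> a1 uA; have aa : a * Num.conj a = 1 by rewrite -normCK a1 expr1n.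
apply: surjective_isometry_unitary => [x y|y].
  by rewrite -[LHS]/(inner (a *: A x) (a *: A y)) innerZl innerZr mulrA aa
    mul1r unitary_inner.
exists (A^† (Num.conj a *: y)).
by rewrite -[LHS]/(a *: A _) unitaryKr// scalerA aa scale1r.
Qed.

Lemma unitaryX A n : unitary A -> unitary (A ^+ n).
Proof.
move=> uA; elim: n => [|n IH]; first exact: unitary1.
by rewrite exprS; exact: unitaryM.
Qed.

Lemma bop_mulE A B x : (A * B) x = A (B x). Proof. by []. Qed.
Lemma bop_scaleE a A x : (a *: A) x = a *: A x. Proof. by []. Qed.
Lemma bop_scaleAl a A B : a *: (A * B) = (a *: A) * B.
Proof. exact: bopP. Qed.
Lemma bop_scaleAr a A B : a *: (A * B) = A * (a *: B).
Proof. by apply: bopP => x; rewrite !(bop_scaleE, bop_mulE) bopZ. Qed.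

Fact ketbra_linear x y : linear (fun z => inner z y *: x).
Proof. by move=> a u v; rewrite innerDl innerZl scalerDl scalerA. Qed.

Fact ketbra_bounded x y : exists M : R[i], forall z, `|inner z y *: x| <= M * `|z|.
Proof.
exists (`|x| * `|y|) => z; rewrite normrZ mulrC -mulrA ler_wpM2l//.
by rewrite mulrC; exact: inner_bound.
Qed.

(* [|x><y|] *)
Definition ketbra x y : bop H := Bop (ketbra_linear x y) (ketbra_bounded x y).

Lemma ketbraE x y z : ketbra x y z = inner z y *: x. Proof. by []. Qed.

Lemma ketbra_adjoint x y : (ketbra x y)^† = ketbra y x.
Proof.
apply: adjointE => u v; rewrite !ketbraE innerZl innerZr inner_conj mulrC.
by [].
Qed.

Lemma mul_ketbra A x y : A * ketbra x y = ketbra (A x) y.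
Proof. by apply: bopP => z; rewrite bop_mulE !ketbraE bopZ. Qed.

Lemma ketbraM x y u v : ketbra x y * ketbra u v = inner u y *: ketbra x v.
Proof. by rewrite mul_ketbra; apply: bopP => z; rewrite bop_scaleE !ketbraE !scalerA mulrC. Qed.

Lemma ketbra_linearl y : linear (ketbra^~ y).
Proof. by move=> a u v; apply: bopP => z; rewrite /= scalerDr !scalerA mulrC. Qed.

(** [V^† W] commutes with every operator. Commutation with [ketbra x e], applied to [e], shows that
    it multiplies each [x] by the same scalar. *)
Lemma implement_unique (f : bop H -> bop H) (V W : bop H) e :
  unitary V -> unitary W -> inner e e = 1 ->
  (forall A, f A * V = V * A) -> (forall A, f A * W = W * A) ->
  W = inner (W e) (V e) *: V.
Proof.
move=> uV uW ee fV fW; apply: bopP => x.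
have comm A : V^† * W * A = A * (V^† * W).
  have fA : f A = V * A * V^† by rewrite -fV -mulrA uV.2 mulr1.
  by rewrite -mulrA -fW fA !mulrA uV.1 mul1r.
have /(congr1 (fun B : bop H => B e)) := comm (ketbra x e).
rewrite !bop_mulE !ketbraE ee scale1r => /(congr1 (fun z => V z)).
rewrite unitaryKr// bopZ bop_scaleE => ->; congr (_ *: _).
by rewrite -[LHS]inner_conj -unitary_adjoint// inner_conj.
Qed.

Lemma linear_fun0 (f : bop H -> bop H) : linear f -> f 0 = 0.
Proof.
by move=> fl; apply: (addrI (f 0)); rewrite addr0 -{1}[f 0]scale1r -fl scale1r addr0.
Qed.

(* The adjoint of a rank one operator is explicit, so the default value in
   [adjoint] is ruled out by injectivity without the Riesz theorem. *)
Lemma automorphism_ketbra_adjoint (f : bop H -> bop H) x y u v :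
  inner y y = 1 -> star_automorphism f ->
  inner (f (ketbra x y) u) v = inner u (f (ketbra y x) v).
Proof.
move=> yy [[fl fm fs] /bij_inj fi].
have f0 := linear_fun0 fl.
have fE := fs (ketbra x y); rewrite ketbra_adjoint in fE.
rewrite fE; have [//|A0] := adjoint_spec_or0 (f (ketbra x y)).
have K0 : ketbra y x = 0 by apply: fi; rewrite fE A0 f0.
have x0 : x = 0.
  apply: inner_eq0; have /(congr1 (fun B : bop H => inner (B x) y)) := K0.
  by rewrite ketbraE innerZl yy mulr1 inner0l.
rewrite A0 x0; have -> : ketbra 0 y = 0 by apply: bopP => z; rewrite ketbraE scaler0.
by rewrite f0 /= inner0l inner0r.
Qed.

(* If [f A = V A V^-1] then [f |x><e| e = inner e (V e) *: V x]: this determines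
   the formula up to a phase, and the normalisation below makes
   [inner (V e) e] positive. *)
Lemma automorphism_implemented (f : bop H -> bop H) e :
  star_automorphism f -> inner e e = 1 ->
  0 < Re (inner (f (ketbra e e) e) e) ->
  exists2 V : bop H, unitary V /\ (forall A, f A * V = V * A) &
    forall x, V x = ((Num.sqrt (Re (inner (f (ketbra e e) e) e)))^-1)%:C%C *:
      f (ketbra x e) e.
Proof.
move=> fa ee N0; set N := Re _ in N0 *; set r : R[i] := (_^-1)%:C%C.
have [[fl [f1 fM] fs] fb] := fa.
pose Vf x := r *: f (ketbra x e) e.
(* [ketbra e e] is idempotent and its image under [f] is symmetric, so this entry is the square norm
   of [f (ketbra e e) e], hence real and nonnegative. *)
have Ni : inner (f (ketbra e e) e) e = N%:C%C.
  have EE : ketbra e e = ketbra e e * ketbra e e by rewrite ketbraM ee scale1r.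
  rewrite /N RRe_real// ger0_real//.
  by rewrite EE fM bop_mulE automorphism_ketbra_adjoint// dnorm_ge0.
have rr : r * Num.conj r * N%:C%C = 1.
  rewrite -normCK /r ger0_norm ?ler0c ?invr_ge0 ?sqrtr_ge0//.
  by rewrite -rmorphXn -rmorphM/= exprVn sqr_sqrtr ?ltW// mulVf ?gt_eqF.
have f0 := linear_fun0 fl.
have Vi x y : inner (Vf x) (Vf y) = inner x y.
  rewrite /Vf innerZl innerZr -inner_conj automorphism_ketbra_adjoint// inner_conj.
  rewrite -bop_mulE -fM ketbraM.
  have -> : f (inner x y *: ketbra e e) = inner x y *: f (ketbra e e).
    by rewrite -[_ *: _ in LHS]addr0 fl f0 addr0.
  by rewrite bop_scaleE innerZl Ni -[RHS]mul1r -rr; ring.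
have Vl : linear Vf.
  move=> a x y; rewrite /Vf ketbra_linearl fl /= scalerDr !scalerA.
  by congr (_ + _); congr (_ *: _); exact: mulrC.
have Vb : exists M : R[i], forall x, `|Vf x| <= M * `|x|.
  by exists 1 => x; rewrite mul1r inner_preserving_norm.
pose V := Bop Vl Vb.
have fV A : f A * V = V * A.
  by apply: bopP => x; rewrite !bop_mulE /= /Vf bopZ -bop_mulE -fM mul_ketbra.
exists V => //; split => //; apply: surjective_isometry_unitary => // y.
(* With [g] inverse to [f] and [K = ketbra y (V e)], the intertwining relation gives
   [V (g K e) = K (V e) = y]. *)
have [g _ gf] := fb; exists (g (ketbra y (V e)) e).
by rewrite -bop_mulE -fV gf bop_mulE ketbraE Vi ee scale1r.
Qed.

End inner_product.

(** * Strong and weak continuity *)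

Section continuity.
Context {R : realType} {H : hilbertType R}.
Implicit Types (x y z : H) (a : R[i]) (A B V : bop H).

Lemma ReD (a b : R[i]) : Re (a + b) = Re a + Re b.
Proof. by case: a; case: b. Qed.
Lemma ReB (a b : R[i]) : Re (a - b) = Re a - Re b.
Proof. by case: a; case: b. Qed.
Lemma conjE a : Num.conj a = (Re a -i* Im a)%C.
Proof. by case: a. Qed.

Lemma Re_bound a (e : R) : `|a| < e%:C%C -> `|Re a| < e.
Proof. by move=> ae; rewrite -ltcR; apply: le_lt_trans (normc_ge_Re _) ae. Qed.

(** Weak continuity is expressed with real parts only; imaginary parts are recovered by this
    rotation. *)
Lemma inner_Im x y : Im (inner x y) = Re (inner x ('i%C *: y)).
Proof. by rewrite innerZr conjE; case: (inner x y) => u v /=; rewrite mul0r mulN1r sub0r opprK. Qed.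

Lemma Re_inner_sym x y : Re (inner x y) = Re (inner y x).
Proof. by rewrite -[in RHS]inner_conj conjE. Qed.

Lemma Re_inner_bound x y (e : R) : `|x| * `|y| < e%:C%C -> `|Re (inner x y)| < e.
Proof. by move=> xy; apply: Re_bound; apply: le_lt_trans xy; exact: inner_bound. Qed.

(** Norms take values in [R[i]], where a positive element has zero imaginary part, so real radii
    suffice. *)
Lemma near_normP {T} {F : set_system T} {FF : Filter F} (f : T -> H) y :
  f @ F --> y <-> forall e : R, 0 < e -> \forall q \near F, `|y - f q| < e%:C%C.
Proof.
split=> [/cvgrPdist_lt fy e e0|fy]; first by apply: fy; rewrite ltcR.
apply/cvgrPdist_lt => -[e e'] e0; have e'0 : e' = 0 by exact: (ger0_Im (ltW e0)).
by rewrite e'0 complexr0 in e0 *; apply: fy; rewrite -ltcR.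
Qed.

Lemma sqr_norm_Re x : (Re (inner x x))%:C%C = `|x| ^+ 2.
Proof. by rewrite sqr_norm_inner RRe_real// ger0_real// dnorm_ge0. Qed.

(** When [f q] and [y] have equal norms, the square of [|y - f q|] is twice
    [Re (inner y y) - Re (inner (f q) y)]. *)
Lemma weak_isometric_cvg {T} {F : set_system T} {FF : Filter F} (f : T -> H) y :
  (forall q, inner (f q) (f q) = inner y y) ->
  Re (inner (f q) y) @[q --> F] --> Re (inner y y) -> f @ F --> y.
Proof.
move=> fi /cvgrPdist_lt fy; apply/near_normP => e e0.
have e20 : 0 < e ^+ 2 / 2 by rewrite divr_gt0// exprn_gt0.
near=> q; rewrite -(@ltr_pXn2r _ 2)// ?nnegrE ?normr_ge0 ?ler0c ?(ltW e0)//.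
rewrite -sqr_norm_Re -rmorphXn ltcR innerBl !innerBr fi !ReB (Re_inner_sym y (f q)).
have /ltr_normlW : `|Re (inner y y) - Re (inner (f q) y)| < e ^+ 2 / 2.
  by near: q; exact: fy.
by set u := Re _; set v := Re _ => /= uv; lra.
Unshelve. all: by end_near. Qed.

Lemma cvg_Re_inner {T} {F : set_system T} {FF : Filter F} (f g : T -> H) x y :
  (forall q, `|g q| = 1) -> `|x| = 1 -> f @ F --> x -> g @ F --> y ->
  Re (inner (f q) (g q)) @[q --> F] --> Re (inner x y).
Proof.
move=> g1 x1 /near_normP fx /near_normP gy; apply/cvgrPdist_lt => e e0.
have e2 : 0 < e / 2 by rewrite divr_gt0.
near=> q; rewrite -ReB.
have -> : inner x y - inner (f q) (g q) = inner (x - f q) (g q) + inner x (y - g q).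
  by rewrite innerBl innerBr; ring.
rewrite ReD (splitr e); apply: le_lt_trans (ler_normD _ _) _.
apply: ltrD; apply: Re_inner_bound.
  by rewrite g1 mulr1; near: q; exact: fx.
by rewrite x1 mul1r; near: q; exact: gy.
Unshelve. all: by end_near. Qed.

Lemma sigma_weak_continuous_inner (T : topologicalType) (F : T -> bop H) :
  continuous (F : T -> sigma_weak_bop H) ->
  forall x y, continuous (fun q => Re (inner (F q x) y)).
Proof.
move=> Fc x y q.
(* Sequences supported at index 0 turn a normal functional into a matrix entry; their partial sums
   are constant from index 1 on. *)
have sqs z : (fun n => if n is 0 then z else 0) \in square_summable H.
  rewrite inE /square_summable /=.
  apply: (@is_cvg_near_cst _ _ (`|z| ^+ 2)).
  exists 1%N => // -[//|n] _; rewrite /series /= big_mkord big_ord_recl big1 ?addr0// => i _.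
  by rewrite normr0 expr0n.
pose p : square_summable H * square_summable H :=
  (SigSub (sqs x), SigSub (sqs y)).
have nf A : normal_functional p A = inner (A x) y.
  apply: (lim_near_cst (@norm_hausdorff _ R[i]^o)).
  exists 1%N => // -[//|n] _; rewrite /series /= big_mkord big_ord_recl big1 ?addr0// => i _.
  by rewrite inner0r.
have : normal_functional p (F q') @[q' --> q] --> normal_functional p (F q).
  apply: (@cvg_comp _ (sigma_weak_bop H) _ F (fun A => normal_functional p A)
    (nbhs q) (nbhs (F q : sigma_weak_bop H))); first exact: Fc.
  have c2 := @proj_continuous (square_summable H * square_summable H)%type (fun=> R[i]^o) p.
  have c1 := @initial_continuous _ _ (fun A : bop H => normal_functional ^~ A :
    {ptws (square_summable H * square_summable H)%type -> R[i]^o}).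
  apply: cvg_comp (c1 _) (c2 _).
move=> /cvgrPdist_lt cF; apply/cvgrPdist_lt => e e0.
near=> q'; rewrite -ReB -!nf; apply: Re_bound.
by near: q'; apply: cF; rewrite ltcR.
Unshelve. all: by end_near. Qed.

Lemma strong_continuous (T : topologicalType) (F : T -> bop H) :
  (forall x, continuous (fun q => F q x)) -> continuous (F : T -> strong_bop H).
Proof.
move=> Fc; apply: continuous_comp_initial => q.
by apply/pointwise_cvgP => x; exact: Fc.
Qed.

Lemma unitary_comp_continuous (T : topologicalType) (F : T -> bop H) (g : T -> H) :
  (forall q, unitary (F q)) -> (forall x, continuous (fun q => F q x)) ->
  continuous g -> continuous (fun q => F q (g q)).
Proof.
move=> uF Fc gc q; apply/near_normP => e e0.
have e2 : 0 < e / 2 by rewrite divr_gt0.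
have /near_normP Fcq := Fc (g q) q; have /near_normP gcq := gc q.
near=> q'; have -> : F q (g q) - F q' (g q') =
    (F q (g q) - F q' (g q)) + F q' (g q - g q') by rewrite bopB addrA subrK.
rewrite (splitr e) rmorphD/=; apply: le_lt_trans (ler_normD _ _) _.
apply: ltrD; first by near: q'; exact: Fcq.
by rewrite unitary_norm//; near: q'; exact: gcq.
Unshelve. all: by end_near. Qed.

(** Applying the isometry [F q'] to the difference of the adjoints at [x] leaves
    [F q' ((F q)^† x) - x], which is small by strong continuity of [F] at [(F q)^† x]. *)
Lemma unitary_adjoint_continuous (T : topologicalType) (F : T -> bop H) :
  (forall q, unitary (F q)) -> (forall x, continuous (fun q => F q x)) ->
  forall x, continuous (fun q => (F q)^† x).
Proof.
move=> uF Fc x q; apply/near_normP => e e0.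
have /near_normP Fcq := Fc ((F q)^† x) q.
near=> q'; rewrite -(unitary_norm (uF q')) bopB unitaryKr//.
by rewrite -{2}(unitaryKr (uF q) x) distrC; near: q'; exact: Fcq.
Unshelve. all: by end_near. Qed.

Lemma unitaryX_continuous (T : topologicalType) (F : T -> bop H) n :
  (forall q, unitary (F q)) -> (forall x, continuous (fun q => F q x)) ->
  forall x, continuous (fun q => (F q ^+ n) x).
Proof.
move=> uF Fc; elim: n => [x q|n IH x]; first exact: cvg_cst.
under [X in continuous X]eq_fun do rewrite exprS bop_mulE.
exact: unitary_comp_continuous.
Qed.

End continuity.

Lemma continuous_compT (T U V : topologicalType) (f : U -> V) (g : T -> U) :
  continuous f -> continuous g -> continuous (fun q => f (g q)).
Proof. by move=> fc gc q; apply: continuous_comp; [exact: gc|exact: fc]. Qed.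

Lemma continuous_pair (T U V : topologicalType) (f : T -> U) (g : T -> V) :
  continuous f -> continuous g -> continuous (fun q => (f q, g q)).
Proof. by move=> fc gc q; apply: cvg_pair; [exact: fc|exact: gc]. Qed.

Lemma continuous_fst (T U : topologicalType) : continuous (@fst T U).
Proof. by move=> q; exact: cvg_fst. Qed.

Lemma continuous_snd (T U : topologicalType) : continuous (@snd T U).
Proof. by move=> q; exact: cvg_snd. Qed.

(** * Continuous cocycles on an interval *)

Section coboundary.
Context {R : realType}.

Lemma max0_continuous : continuous (fun s : R => Num.max s 0).
Proof.
apply: (continuous_compT (g := fun s => (s, 0)) (@max_continuous _ R)).
by apply: continuous_pair => s; [exact: cvg_id|exact: cvg_cst].
Qed.

Lemma primitive_exists (f : R -> R) : continuous f ->
  exists2 F : R -> R, F 0 = 0 & forall s : R, 0 <= s -> is_derive s 1 F (f s).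
Proof.
(* Integrating from -1 makes every [s >= 0] an interior point, so the derivative at 0 is
   two-sided. *)
move=> fc; pose F s := (\int[lebesgue_measure]_(t in `[-1, s]) f t)%R.
have Fd (s : R) : 0 <= s -> is_derive s 1 F (f s).
  move=> s0.
  have ss1 : s < s + 1 by rewrite ltrDl.
  have [] := @continuous_FTC1_closed R f (-1) s (s + 1) ss1.
  - apply: continuous_compact_integrable; first exact: segment_compact.
    exact: continuous_subspaceT.
  - by rewrite (lt_le_trans _ s0)// ltrN10.
  - exact: fc.
  by move=> dF dE; split => //; rewrite -derive1E.
exists (fun s => F s - F 0); first by rewrite subrr.
move=> s s0; have ? := Fd s s0; rewrite -[f s]subr0; exact: is_deriveB.
Qed.

Lemma derive_dist (F G f g : R -> R) (a e : R) : 0 <= a ->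
  (forall s : R, 0 <= s -> is_derive s 1 F (f s)) ->
  (forall s : R, 0 <= s -> is_derive s 1 G (g s)) ->
  (forall s, 0 <= s <= a -> `|f s - g s| <= e) ->
  `|(F a - F 0) - (G a - G 0)| <= e * a.
Proof.
move=> a0 Fd Gd fg.
have d (s : R) : 0 <= s -> is_derive s 1 (F - G) (f s - g s).
  by move=> s0; have ? := Fd s s0; have ? := Gd s s0; exact: is_deriveB.
have [s sa| |c ca] := @MVT_segment R (F - G) (fun s => f s - g s) 0 a a0.
- by apply: d; move: sa; rewrite in_itv/= => /andP[/ltW].
- apply: derivable_within_continuous => s; rewrite in_itv/= => /andP[s0 _].
  by have ? := d s s0; exact: ex_derive.
rewrite subr0 => E; have {}E : F a - G a - (F 0 - G 0) = (f c - g c) * a by [].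
have -> : F a - F 0 - (G a - G 0) = (f c - g c) * a by rewrite -E; ring.
by rewrite normrM (ger0_norm a0) ler_wpM2r// fg.
Qed.

Lemma derive_eq (F G f g : R -> R) (a : R) : 0 <= a ->
  (forall s : R, 0 <= s -> is_derive s 1 F (f s)) ->
  (forall s : R, 0 <= s -> is_derive s 1 G (g s)) ->
  (forall s, 0 <= s <= a -> f s = g s) ->
  F a - F 0 = G a - G 0.
Proof.
move=> a0 Fd Gd fg; have := @derive_dist F G f g a 0 a0 Fd Gd.
rewrite mul0r normr_le0 subr_eq0 => /(_ _)/eqP; apply=> s sa.
by rewrite fg// subrr normr0.
Qed.

Lemma is_derive_translate (F : R -> R) (a s l : R) :
  is_derive (a + s) 1 F l -> is_derive s 1 (fun u => F (a + u)) l.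
Proof.
move=> dF; rewrite -[l]mulr1.
have da : is_derive s 1 (fun u => a + u) 1.
  by rewrite -[X in is_derive _ _ _ X]add0r; exact: is_deriveD.
exact: (@is_derive1_comp _ F (fun u => a + u)).
Qed.

(** A tube lemma: compactness of [[0, a]] makes continuity in the parameter uniform along the
    segment. *)
Lemma uniform_near_segment (T : topologicalType) (f : T -> R -> R) (q0 : T) (a e : R) :
  continuous (fun p : T * R => f p.1 p.2) -> 0 < e ->
  \forall q \near q0, forall s, 0 <= s <= a -> `|f q s - f q0 s| <= e.
Proof.
move=> fc e0; have e2 : 0 < e / 2 by rewrite divr_gt0.
have /compact_near_coveringP/(_ _ (nbhs q0) (fun q s => `|f q s - f q0 s| <= e) _)
  := @segment_compact R 0 a.
move=> cover; apply: filterS (cover _).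
  by move=> q Pq s sa; apply: Pq; rewrite /= in_itv.
move=> s _; have /cvgrPdist_lt/(_ _ e2) [[P Q] /= [Pq0 Qs] PQ] := fc (q0, s).
exists (Q, P) => // -[s' q] [/= Qs' Pq].
have h1 := PQ (q, s') (conj Pq Qs').
have h2 := PQ (q0, s') (conj (nbhs_singleton Pq0) Qs').
rewrite -(subrKA (f q0 s)) (splitr e) (le_trans (ler_normD _ _))// lerD ?ltW//.
by rewrite distrC.
Qed.

(** The change in the parameter is controlled by [derive_dist], since the integrands are uniformly
    close, and the change in time by differentiability of [F q0]. The maximum restricts the claim to
    times where the derivative is known. *)
Lemma parametric_primitive (T : topologicalType) (f : T -> R -> R) :
  continuous (fun p : T * R => f p.1 p.2) ->
  exists F : T -> R -> R,
    [/\ forall q, F q 0 = 0,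
        forall q (s : R), 0 <= s -> is_derive s 1 (F q) (f q s) &
        continuous (fun p : T * R => F p.1 (Num.max p.2 0))].
Proof.
move=> fc.
have fqc q : continuous (f q).
  apply: (continuous_compT (g := pair q) fc).
  by apply: continuous_pair => s; [exact: cvg_cst|exact: cvg_id].
have /choice[F FP] q : exists F : R -> R, F 0 = 0 /\
    forall s : R, 0 <= s -> is_derive s 1 F (f q s).
  by have [F F0 Fd] := primitive_exists (fqc q); exists F.
exists F; split=> [q|q s s0|]; [exact: (FP q).1|exact: (FP q).2|].
move=> [q0 s0] /=; apply/cvgrPdist_lt => e e0.
pose m := Num.max s0 0; have m0 : 0 <= m by rewrite le_max lexx orbT.
have e2 : 0 < e / 2 by rewrite divr_gt0.
(* Times near [s0] stay below [m + 1 < m + 2], so an integrand error [e'] accumulates to less than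
   [e / 2]. *)
pose e' := e / 2 / (m + 2); have e'0 : 0 < e' by rewrite divr_gt0// ltr_wpDl.
have maxc : Num.max s 0 @[s --> s0] --> m.
  exact: max0_continuous.
have Fc : {for m, continuous (F q0)}.
  apply/differentiable_continuous/derivable1_diffP.
  by have ? := (FP q0).2 m m0; exact: ex_derive.
have near1 : \forall p \near (q0, s0), forall s, 0 <= s <= m + 1 ->
    `|f p.1 s - f q0 s| <= e'.
  apply: (@continuous_fst T R (q0, s0) _ (uniform_near_segment q0 (m + 1) fc e'0)).
have near2 : \forall p \near (q0, s0), Num.max p.2 0 < m + 1.
  apply: (@continuous_snd T R (q0, s0) (fun s => Num.max s 0 < m + 1)).
  by apply: (cvgr_lt _ maxc); rewrite ltrDl.
have near3 : \forall p \near (q0, s0), `|F q0 m - F q0 (Num.max p.2 0)| < e / 2.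
  apply: (@continuous_snd T R (q0, s0) (fun s => `|F q0 m - F q0 (Num.max s 0)| < e / 2)).
  have : F q0 (Num.max s 0) @[s --> s0] --> F q0 m := cvg_comp _ _ maxc Fc.
  by move=> /cvgrPdist_lt; apply.
near=> p.
have fe : forall s, 0 <= s <= m + 1 -> `|f p.1 s - f q0 s| <= e' by near: p.
have sm : Num.max p.2 0 < m + 1 by near: p.
have Fe : `|F q0 m - F q0 (Num.max p.2 0)| < e / 2 by near: p.
move: sm Fe; set s := Num.max p.2 0 => sm Fe.
have s0' : 0 <= s by rewrite le_max lexx orbT.
have E : `|F q0 s - F p.1 s| < e / 2.
  apply: (@le_lt_trans _ _ (e' * s)).
    have := @derive_dist (F p.1) (F q0) _ _ s e' s0' (FP p.1).2 (FP q0).2.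
    rewrite (FP p.1).1 (FP q0).1 !subr0 distrC; apply=> u /andP[u0 us].
    by apply: fe; rewrite u0 (le_trans us)// ltW.
  rewrite /e' mulrAC ltr_pdivrMr ?ltr_wpDl// ltr_pM2l//.
  by rewrite (lt_trans sm)// ltrD2l ltr1n.
rewrite -(subrKA (F q0 s)) (splitr e) (le_lt_trans (ler_normD _ _))// ltrD.
Unshelve. all: by end_near. Qed.

(* With [B_s] a primitive of [b s] and [D] one of [b ^~ d], the function [g] is
   [(B_t d - D t) / d]. Integrating the cocycle identity in its last variable over
   [0, d] writes [d * b s t] as the coboundary of [t |-> B_t d] plus an error
   [B_s (t + d) - B_s t - B_s d]; the identity at [(s, v, d)], integrated in [v]
   over [0, t], turns this error into the coboundary of [- D]. *)
Lemma continuous_coboundary (X : topologicalType) (b : X -> R -> R -> R) (d : R) :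
  0 < d -> continuous (fun q : X * (R * R) => b q.1 q.2.1 q.2.2) ->
  (forall x s t r, 0 <= s <= d -> 0 <= t <= d -> 0 <= r <= d ->
    b x s t + b x (s + t) r = b x s (t + r) + b x t r) ->
  exists2 g : X -> R -> R, continuous (fun q : X * R => g q.1 q.2) &
    forall x s t, 0 <= s -> 0 <= t -> s + t <= d ->
      b x s t = g x s + g x t - g x (s + t).
Proof.
move=> d0 bc bP.
have [|B [B0 Bd Bc]] := @parametric_primitive (X * R)%type (fun q r => b q.1 q.2 r).
  apply: (continuous_compT (g := fun p : X * R * R => (p.1.1, (p.1.2, p.2))) bc).
  apply: continuous_pair; last apply: continuous_pair.
  - by apply: continuous_compT; exact: continuous_fst.
  - by apply: continuous_compT; [exact: continuous_snd|exact: continuous_fst].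
  - exact: continuous_snd.
have [|D [D0 Dd Dc]] := @parametric_primitive X (fun x s => b x s d).
  apply: (continuous_compT (g := fun p : X * R => (p.1, (p.2, d))) bc).
  apply: continuous_pair; first exact: continuous_fst.
  by apply: continuous_pair => s; [exact: cvg_snd|exact: cvg_cst].
exists (fun x t => (B (x, t) d - D x (Num.max t 0)) / d).
  have cB : continuous (fun p : X * R => B (p.1, p.2) d).
    rewrite -(max_l (ltW d0)).
    apply: (continuous_compT (g := fun p : X * R => ((p.1, p.2), d)) Bc).
    apply: continuous_pair => [|p]; last exact: cvg_cst.
    by apply: continuous_pair; [exact: continuous_fst|exact: continuous_snd].
  move=> [x t]; apply: cvgM; last exact: cvg_cst.
  by apply: cvgB; [exact: cB|exact: Dc].
move=> x s t s0 t0 std.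
have sd : s <= d by lra.
have td : t <= d by lra.
have st0 : 0 <= s + t by rewrite addr_ge0.
rewrite !max_l//.
have E1 : B (x, s + t) d + b x s t * d =
    B (x, s) (t + d) + B (x, t) d - B (x, s) t.
  have := @derive_eq (fun u => B (x, s + t) u + b x s t * u)
    (fun u => B (x, s) (t + u) + B (x, t) u)
    (fun u => b x (s + t) u + b x s t) (fun u => b x s (t + u) + b x t u) d (ltW d0).
  rewrite !B0 !(mulr0, addr0, subr0); apply.
  - move=> u u0; apply: is_deriveD; first exact: Bd.
    by rewrite -[X in is_derive _ _ _ X]mulr1; exact: is_deriveZ.
  - move=> u u0; apply: is_deriveD; last exact: Bd.
    by apply: is_derive_translate; apply: Bd; rewrite addr_ge0.
  - by move=> u /andP[u0 ud]; rewrite addrC bP// ?s0 ?t0 ?u0.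
have E2 : B (x, s) (t + d) + D x t - B (x, s) d = B (x, s) t + D x (s + t) - D x s.
  have := @derive_eq (fun v => B (x, s) (v + d) + D x v)
    (fun v => B (x, s) v + D x (s + v))
    (fun v => b x s (v + d) + b x v d) (fun v => b x s v + b x (s + v) d) t t0.
  rewrite !B0 !D0 !(add0r, addr0); apply.
  - move=> v v0; apply: is_deriveD; last exact: Dd.
    under eq_fun do rewrite addrC.
    by rewrite addrC; apply: is_derive_translate; apply: Bd; rewrite addr_ge0// ltW.
  - move=> v v0; apply: is_deriveD; first exact: Bd.
    by apply: is_derive_translate; apply: Dd; rewrite addr_ge0.
  - by move=> v /andP[v0 vd]; rewrite bP// ?s0 ?v0 ?lexx ?(ltW d0)//= (le_trans vd).
have E : b x s t * d = (B (x, s) d - D x s) + (B (x, t) d - D x t)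
    - (B (x, s + t) d - D x (s + t)) by lra.
by rewrite -mulrDl -mulrBl -E mulfK// gt_eqF.
Qed.

End coboundary.

(** * Complex numbers of modulus one and their logarithms *)

Section phase.
Context {R : realType}.
Implicit Types (s t : R) (z : R[i]).

Definition expi t : R[i] := (cos t +i* sin t)%C.

Lemma expiD s t : expi (s + t) = expi s * expi t.
Proof.
by rewrite /expi cosD sinD; apply/eqP; rewrite eq_complex /= eqxx/= addrC.
Qed.

Lemma sqr_normE z : `|z| ^+ 2 = (Re z ^+ 2 + Im z ^+ 2)%:C%C.
Proof. by rewrite add_Re2_Im2. Qed.

Lemma norm_eq1 z : `|z| = 1 -> Re z ^+ 2 + Im z ^+ 2 = 1.
Proof. by move=> z1; apply/complexI; rewrite -sqr_normE z1 expr1n. Qed.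

Lemma norm_expi t : `|expi t| = 1.
Proof. by apply/eqP; rewrite -(@eqrXn2 _ 2)// sqr_normE cos2Dsin2 expr1n. Qed.

(** The strict bounds place [Im z] in the open interval where [asin] is continuous. *)
Lemma Im_itv z : `|z| = 1 -> 0 < Re z -> -1 < Im z < 1.
Proof.
move=> /norm_eq1 z1 z0; rewrite -ltr_norml -(@ltr_pXn2r _ 2)// ?nnegrE//.
by rewrite expr1n real_normK ?num_real// -z1 ltrDr exprn_gt0.
Qed.

(** On the right half of the unit circle the real part is the positive root of [1 - Im z ^+ 2], so
    [asin (Im z)] is a logarithm there. *)
Lemma expi_asin z : `|z| = 1 -> 0 < Re z -> expi (asin (Im z)) = z.
Proof.
move=> z1 z0; have /andP[/ltW zl /ltW zr] := Im_itv z1 z0.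
rewrite /expi cos_asin ?zl// asinK ?in_itv/= ?zl//.
rewrite -(norm_eq1 z1) addrK sqrtr_sqr gtr0_norm//.
by case: (z).
Qed.

Lemma Re_expiM t z : Re (expi t * z) = cos t * Re z - sin t * Im z.
Proof. by case: z. Qed.

(** With [u] half the difference, [cos (u *+ 2) = 1] forces [sin u = 0], and [sin] has no zero in
    the open interval from 0 to [pi]. *)
Lemma expi_inj s t : expi s = expi t -> `|s - t| < pi *+ 2 -> s = t.
Proof.
move=> st stpi; pose u := (s - t) / 2.
have uE : s - t = u *+ 2 by rewrite /u -mulr_natr divfK.
have cu : cos (u *+ 2) = 1.
  case: st => cst sst; rewrite -uE cosB cst sst -!expr2.
  exact: cos2Dsin2.
have su : sin u = 0.
  apply: cos1sin0; apply/eqP; rewrite -(@eqrXn2 _ 2)// real_normK ?num_real//.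
  by move: cu; rewrite cos_mulr2n => cu; rewrite expr1n; apply/eqP; lra.
have upi : `|u| < pi by rewrite -(@ltr_pMn2r _ 2)// -normrMn -uE.
apply/eqP; rewrite -subr_eq0 uE mulrn_eq0/=; apply/contraT => u0.
have : 0 < sin `|u| by apply: sin_gt0_pi; rewrite normr_gt0 u0.
by case: (ger0P u) => _; rewrite ?sinN su ?oppr0 ltxx.
Qed.

End phase.

(** * Retraction onto an interval and uniformity over a compact space *)

Section clamp.
Context {R : realType}.

(** For [0 <= d] this is the retraction of the line onto [[0, d]]. It extends functions controlled
    only at small times to continuous functions of all times. *)
Definition clamp (d t : R) := Num.min (Num.max t 0) d.

Lemma clamp_continuous d : continuous (clamp d).
Proof.
have h : continuous (fun t : R => (Num.max t 0, d)).
  by apply: continuous_pair => s; [exact: max0_continuous|exact: cvg_cst].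
exact: continuous_compT (@min_continuous _ R) h.
Qed.

Lemma clamp_itv d t : 0 <= d -> 0 <= clamp d t <= d.
Proof. by move=> d0; rewrite /clamp le_min le_max lexx orbT d0 ge_min lexx orbT. Qed.

Lemma clampE d t : 0 <= t <= d -> clamp d t = t.
Proof. by move=> /andP[t0 td]; rewrite /clamp max_l// min_l. Qed.

Lemma compact_near_pos (X T : topologicalType) (f : X -> T -> R) (t0 : T) :
  compact [set: X] -> continuous (fun p : X * T => f p.1 p.2) ->
  (forall x, 0 < f x t0) -> \forall t \near t0, forall x, 0 < f x t.
Proof.
move=> /compact_near_coveringP cX fc f0.
apply: filterS (cX _ (nbhs t0) (fun t x => 0 < f x t) _ _) => [t Pt x|x _].
  exact: Pt.
have [[P Q] /= [Px Qt] PQ] : nbhs (x, t0) (fun p => 0 < f p.1 p.2).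
  by apply: (cvgr_gt _ (fc (x, t0))); exact: f0.
by exists (P, Q) => // -[x' t] [/= Px' Qt']; exact: (PQ (x', t)).
Qed.

Lemma nbhs0_itv (A : set R) : nbhs 0 A ->
  exists2 d, 0 < d & forall t, 0 <= t <= d -> A t.
Proof.
case/nbhs_ballP => r /= r0 rA; exists (r / 2); first by rewrite divr_gt0.
move=> t /andP[t0 tr]; apply: rA; rewrite /ball/= sub0r normrN ger0_norm//.
by rewrite (le_lt_trans tr)// ltr_pdivrMr// ltr_pMr// ltr1n.
Qed.

End clamp.

(** * Implementation for small times *)

Section local_semigroup.
Context {R : realType} {H : hilbertType R} {X : topologicalType}.
Implicit Types (x : X) (s t r : R) (xi eta : H).

(** The semigroup law is required at nonnegative times only, so that the definition covers both
    [alpha] and a reference semigroup extended by the identity to negative times. *)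
Definition weakly_continuous_family (a : X -> R -> bop H -> bop H) :=
  [/\ forall x t, star_automorphism (a x t),
      forall x, a x 0 = id,
      forall x s t, 0 <= s -> 0 <= t -> a x (s + t) = a x s \o a x t &
      forall A xi eta,
        continuous (fun p : X * R => Re (inner (a p.1 p.2 A xi) eta))].

Lemma weak_unitary_continuous (T : topologicalType) (F : T -> bop H) :
  (forall q, unitary (F q)) ->
  (forall xi eta, continuous (fun q => Re (inner (F q xi) eta))) ->
  forall xi, continuous (fun q => F q xi).
Proof.
move=> uF Fc xi q; apply: weak_isometric_cvg; last exact: Fc.
by move=> q'; rewrite !unitary_inner.
Qed.

Lemma ReM_real (r : R) (z : R[i]) : Re (r%:C%C * z) = r * Re z.
Proof. by case: z => u v /=; rewrite mul0r subr0. Qed.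

(** The entry [N x t] equals 1 at [t = 0]; by compactness it stays positive for all [x] on a common
    interval [[0, d]], where the explicit implementers exist. Clamping the time makes [V] total and
    continuous. *)
Lemma local_projective (a : X -> R -> bop H -> bop H) (e : H) :
  compact [set: X] -> weakly_continuous_family a -> inner e e = 1 ->
  exists2 d : R, 0 < d &
    exists V : X -> R -> bop H,
    [/\ forall x t, unitary (V x t),
        forall xi eta, continuous (fun p : X * R => Re (inner (V p.1 p.2 xi) eta)),
        forall x, V x 0 = 1 &
        forall x t, 0 <= t <= d -> forall A, a x t A * V x t = V x t * A].
Proof.
move=> cX [aut a0 aD ac] ee.
pose N x t := Re (inner (a x t (ketbra e e) e) e).
have N0 x : N x 0 = 1 by rewrite /N a0 ketbraE ee scale1r ee.
have /nbhs0_itv[d d0 Nd] : \forall t \near (0 : R), forall x, 0 < N x t.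
  by apply: compact_near_pos => // [|x]; [exact: ac|rewrite N0].
have Nc x t : 0 < N x (clamp d t) by apply: Nd; rewrite clamp_itv// ltW.
exists d => //.
have /choice[V VP] (p : X * R) : exists V : bop H,
    [/\ unitary V, forall A, a p.1 (clamp d p.2) A * V = V * A &
     forall xi, V xi = ((Num.sqrt (N p.1 (clamp d p.2)))^-1)%:C%C *:
       a p.1 (clamp d p.2) (ketbra xi e) e].
  have [V [uV VA] VE] := automorphism_implemented (aut p.1 (clamp d p.2)) ee (Nc _ _).
  by exists V.
have cc : continuous (fun p : X * R => (p.1, clamp d p.2)).
  apply: continuous_pair; first exact: continuous_fst.
  by apply: continuous_compT; [exact: clamp_continuous|exact: continuous_snd].
exists (fun x t => V (x, t)); split => [x t|xi eta|x|x t td A].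
- by have [] := VP (x, t).
- under [X in continuous X]eq_fun => p.
    have [_ _ ->] := VP (p.1, p.2); rewrite innerZl ReM_real /=; over.
  move=> p; apply: cvgM; last first.
    exact: (continuous_compT (ac (ketbra xi e) e eta) cc).
  apply: cvgV; first by rewrite gt_eqF// sqrtr_gt0.
  have cN := continuous_compT (ac (ketbra e e) e e) cc.
  exact: (continuous_compT (@sqrt_continuous R) cN).
- apply: bopP => xi; have [_ _ ->] := VP (x, 0); rewrite /= clampE ?lexx ?ltW//.
  by rewrite N0 sqrtr1 invr1 scale1r a0 ketbraE ee scale1r.
- by have [_ /= VA _] := VP (x, t); rewrite -VA clampE.
Qed.

Lemma local_unitary_semigroup (a : X -> R -> bop H -> bop H) (e : H) :
  compact [set: X] -> weakly_continuous_family a -> inner e e = 1 ->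
  exists2 d : R, 0 < d &
    exists U : X -> R -> bop H,
    [/\ forall x t, unitary (U x t),
        forall xi, continuous (fun p : X * R => U p.1 p.2 xi),
        forall x t, 0 <= t <= d -> forall A, a x t A * U x t = U x t * A &
        forall x s t, 0 <= s -> 0 <= t -> s + t <= d ->
          U x (s + t) = U x s * U x t].
Proof.
move=> cX fam ee; have [delta delta0 [V [uV wV V0 VA]]] := local_projective cX fam ee.
have [aut a0 aD ac] := fam.
have sV := @weak_unitary_continuous _ (fun p : X * R => V p.1 p.2)
  (fun p => uV p.1 p.2) wV.
(* The scalar by which [V_s V_t] differs from [V_(s+t)], read off at the unit vector [e]. *)
pose c x s t := inner (V x s (V x t e)) (V x (s + t) e).
have ne : `|e| = 1.
  by apply/eqP; rewrite -(@eqrXn2 _ 2)// sqr_norm_inner ee expr1n.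
have c21 : continuous (fun q : X * (R * R) => q.2.1).
  exact: continuous_compT (@continuous_fst _ _) (@continuous_snd _ _).
have c22 : continuous (fun q : X * (R * R) => q.2.2).
  exact: continuous_compT (@continuous_snd _ _) (@continuous_snd _ _).
have c2D : continuous (fun q : X * (R * R) => q.2.1 + q.2.2).
  by move=> q; apply: cvgD; [exact: c21|exact: c22].
have sVc (h : X * (R * R) -> R) : continuous h -> forall xi,
    continuous (fun q : X * (R * R) => V q.1 (h q) xi).
  move=> hc xi; apply: (continuous_compT (g := fun q => (q.1, h q)) (sV xi)).
  by apply: continuous_pair => //; exact: continuous_fst.
have cRe xi : `|xi| = 1 -> continuous (fun q : X * (R * R) =>
    Re (inner (V q.1 q.2.1 (V q.1 q.2.2 e)) (V q.1 (q.2.1 + q.2.2) xi))).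
  move=> nxi q; apply: cvg_Re_inner.
  - by move=> q'; rewrite unitary_norm.
  - by rewrite !unitary_norm.
  - apply: (@unitary_comp_continuous _ _ _ (fun q : X * (R * R) => V q.1 q.2.1)).
    + by move=> ?; exact: uV.
    + exact: sVc.
    + exact: sVc.
  - exact: sVc.
have cIm : continuous (fun q : X * (R * R) => Im (c q.1 q.2.1 q.2.2)).
  under [X in continuous X]eq_fun do rewrite inner_Im -bopZ.
  by apply: cRe; rewrite normrZ ne mulr1; apply/eqP; rewrite -(@eqrXn2 _ 2)// sqr_normE/=
    expr0n add0r !expr1n.
(* The cocycle identity for times at most [d] evaluates [c] at times up to [2 d], whose sums reach
   [4 d] and must stay where [V] implements. Positivity of [Re c] holds near [(0, 0)] because
   [c x 0 0 = 1]. *)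
have [d d0 [dd cd]] : exists2 d, 0 < d & d *+ 4 <= delta /\
    forall x s t, 0 <= s <= d *+ 2 -> 0 <= t <= d *+ 2 -> 0 < Re (c x s t).
  have [|[A B] /= [/nbhs0_itv[p p0 pA] /nbhs0_itv[q q0 qB]] AB] :=
    @compact_near_pos R X (R * R)%type (fun x p => Re (c x p.1 p.2)) (0, 0)
      cX (cRe e ne).
    by move=> x; rewrite /c addr0 V0 /= ee.
  pose m := Num.min p q; have m0 : 0 < m by rewrite lt_min p0.
  exists (Num.min (m / 2) (delta / 4)); first by rewrite lt_min !divr_gt0.
  set d := Num.min _ _.
  have dm : d <= m / 2 by rewrite ge_min lexx.
  have ddelta : d <= delta / 4 by rewrite ge_min lexx orbT.
  split; first by rewrite -mulr_natr -ler_pdivlMr.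
  move=> x s t /andP[s0 sd] /andP[t0 td].
  have d2m : d *+ 2 <= m by rewrite -mulr_natr -ler_pdivlMr.
  have := d2m; rewrite le_min => /andP[dp dq].
  apply: (AB (s, t)); split => /=.
    by apply: pA; rewrite s0 (le_trans sd).
  by apply: qB; rewrite t0 (le_trans td).
have VV x s t : 0 <= s <= d *+ 2 -> 0 <= t <= d *+ 2 ->
    V x s * V x t = c x s t *: V x (s + t).
  move=> /andP[s0 sd] /andP[t0 td].
  have sdelta : s <= delta by lra.
  have tdelta : t <= delta by lra.
  apply: (implement_unique (f := a x (s + t))) => //.
  - exact: unitaryM.
  - by move=> A; rewrite VA// addr_ge0//=; lra.
  - move=> A; rewrite aD// /= mulrA VA ?s0// -mulrA VA ?t0//.
    by rewrite mulrA.
have c1 x s t : 0 <= s <= d *+ 2 -> 0 <= t <= d *+ 2 -> `|c x s t| = 1.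
  move=> sd td; have := congr1 (fun A : bop H => `|A e|) (VV x s t sd td).
  by rewrite bop_scaleE normrZ bop_mulE !unitary_norm// ne mulr1.
pose k := clamp (d *+ 2).
have d2 : 0 <= d *+ 2 by rewrite mulrn_wge0// ltW.
have kd s : 0 <= k s <= d *+ 2 by exact: clamp_itv.
pose b x s t := asin (Im (c x (k s) (k t))).
have Imc x s t := Im_itv (c1 x _ _ (kd s) (kd t)) (cd x _ _ (kd s) (kd t)).
have bE x s t : 0 <= s <= d *+ 2 -> 0 <= t <= d *+ 2 -> expi (b x s t) = c x s t.
  by move=> sd td; rewrite /b /k !clampE// expi_asin// ?c1// cd.
(* Each side of the cocycle identity has two terms below [pi / 2] in absolute value, so the sides
   differ by less than [2 pi] and [expi_inj] applies. *)
have bpi x s t : `|b x s t| < pi / 2.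
  have /andP[lb ub] := Imc x s t.
  by rewrite ltr_norml asin_gtNpi2 ?asin_ltpi2// ?lb ?ub ltW.
have [|x s t r /andP[s0 sd] /andP[t0 td] /andP[r0 rd]|g gc gE] :=
    @continuous_coboundary R X b d d0.
- have kc : continuous (fun q : X * (R * R) => (q.1, (k q.2.1, k q.2.2))).
    apply: continuous_pair; first exact: continuous_fst.
    by apply: continuous_pair; apply: continuous_compT => //; exact: clamp_continuous.
  move=> q; apply: (@continuous_comp _ _ _ _ (@asin R) q).
    exact: (continuous_compT cIm kc).
  by apply: continuous_asin; exact: Imc.
- apply: expi_inj; last first.
    have := (bpi x s t, bpi x (s + t) r, bpi x s (t + r), bpi x t r).
    rewrite !ltr_norml => -[[[/andP[? ?] /andP[? ?]] /andP[? ?]] /andP[? ?]].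
    by apply/andP; split; lra.
  rewrite !expiD !bE; try by apply/andP; split; lra.
  (* Both sides compute the product [V_s V_t V_r], bracketed in the two possible ways. *)
  have VVV : (c x s t * c x (s + t) r) *: V x (s + t + r) =
      (c x s (t + r) * c x t r) *: V x (s + t + r).
    rewrite -scalerA -VV; [|by apply/andP; split; lra..].
    rewrite bop_scaleAl -VV; [|by apply/andP; split; lra..].
    rewrite -mulrA VV; [|by apply/andP; split; lra..].
    rewrite -bop_scaleAr VV; [|by apply/andP; split; lra..].
    by rewrite scalerA addrA mulrC.
  move/(congr1 (fun A : bop H => A e)): VVV; rewrite !bop_scaleE => /eqP.
  rewrite -subr_eq0 -scalerBl scaler_eq0 subr_eq0 => /orP[/eqP//|/eqP Ve0].
  have := unitary_norm (uV x (s + t + r)) e.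
  by rewrite Ve0 normr0 ne => /eqP; rewrite eq_sym oner_eq0.
exists d => //; exists (fun x t => expi (- g x t) *: V x t).
split=> [x t|||].
- by apply: unitaryZ => //; exact: norm_expi.
- apply: weak_unitary_continuous => [p|xi eta].
    by apply: unitaryZ => //; exact: norm_expi.
  under [X in continuous X]eq_fun do
    rewrite bop_scaleE innerZl Re_expiM inner_Im.
  have gNc : continuous (fun p : X * R => - g p.1 p.2).
    by move=> p; apply: cvgN; exact: gc.
  move=> p; apply: cvgB; apply: cvgM.
  + exact: continuous_compT (@continuous_cos R) gNc p.
  + exact: wV.
  + exact: continuous_compT (@continuous_sin R) gNc p.
  + exact: wV.
- move=> x t /andP[t0 td] A; rewrite -bop_scaleAr VA ?bop_scaleAl//.
  by apply/andP; split => //; lra.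
- move=> x s t s0 t0 std; rewrite -bop_scaleAl -bop_scaleAr VV;
    [|by apply/andP; split; lra..].
  rewrite !scalerA -mulrA -bE; [|by apply/andP; split; lra..].
  by rewrite -!expiD gE//; congr (expi _ *: _); ring.
Qed.

End local_semigroup.

(** * Extension to all times *)

Section global.
Context {R : realType} {H : hilbertType R} {X : topologicalType}.
Implicit Types (x : X) (s t : R) (A : bop H).

Lemma unitary_idem1 A : unitary A -> A * A = A -> A = 1.
Proof. by move=> [AA _] /(congr1 (fun B => A^† * B)); rewrite mulrA AA mul1r. Qed.

Lemma unitary_semigroup (a : X -> R -> bop H -> bop H) (e : H) :
  compact [set: X] -> weakly_continuous_family a -> inner e e = 1 ->
  exists U : X -> R -> bop H,
    [/\ forall x t, unitary (U x t),
        forall xi, continuous (fun p : X * R => U p.1 p.2 xi),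
        forall x s t, 0 <= s -> 0 <= t -> U x (s + t) = U x s * U x t &
        forall x t, 0 <= t -> forall A, a x t A * U x t = U x t * A].
Proof.
move=> cX fam ee; have [d d0 [L [uL cL LA LD]]] := local_unitary_semigroup cX fam ee.
have [_ a0 aD _] := fam.
have L0 x : L x 0 = 1.
  by apply: unitary_idem1 => //; rewrite -LD ?lexx ?addr0// ltW.
have LX x (u : R) n : 0 <= u -> u *+ n <= d -> L x (u *+ n) = L x u ^+ n.
  move=> u0; elim: n => [|n IH]; first by rewrite mulr0n L0.
  move=> nd; rewrite mulrS LD ?mulrn_wge0//; last by rewrite -mulrS.
  by rewrite IH ?exprS// (le_trans _ nd)// mulrS lerDr.
(* The time is cut into [m.+1] equal pieces, the successor avoiding division by zero. *)
pose E x t (m : nat) := L x (t / m.+1%:R) ^+ m.+1.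
have divd t m : t <= d *+ m.+1 -> t / m.+1%:R <= d.
  by move=> td; rewrite ler_pdivrMr// mulr_natr.
(* Cutting each piece further into [n.+1] parts does not change the product; the common refinement
   is symmetric in [m] and [n], which gives independence of the number of pieces. *)
have Esub x t m n : 0 <= t -> t <= d *+ m.+1 ->
    E x t m = L x (t / (m.+1 * n.+1)%:R) ^+ (m.+1 * n.+1).
  move=> t0 tm; have E1 : t / m.+1%:R = (t / (m.+1 * n.+1)%:R) *+ n.+1.
    by rewrite natrM invfM mulrA -[RHS]mulr_natr divfK// pnatr_eq0.
  rewrite /E E1 LX -?exprM ?(mulnC n.+1)// -?E1 ?divd//.
  by rewrite divr_ge0.
have Eindep x t m n : 0 <= t -> t <= d *+ m.+1 -> t <= d *+ n.+1 -> E x t m = E x t n.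
  by move=> t0 tm tn; rewrite (Esub x t m n)// (Esub x t n m)// mulnC.
pose m (t : R) := Num.truncn (t / d).
have mP t : t <= d *+ (m t).+1.
  by rewrite -mulr_natl -ler_pdivrMr// ltW// truncnS_gt.
pose U x t := E x (Num.max t 0) (m (Num.max t 0)).
have UE x t n : 0 <= t -> t <= d *+ n.+1 -> U x t = E x t n.
  by move=> t0 td; rewrite /U max_l//; apply: Eindep.
exists U; split=> [x t|xi|x s t s0 t0|x t t0 A].
- exact: unitaryX.
(* The number of pieces in [U] jumps with [t], but one fixed [n] serves all times near [t0], where
   [U] is a fixed power of the continuous family [L]. *)
- move=> [x0 t0]; pose n := m (Num.max t0 0 + 1).
  have near_n : \forall p \near (x0, t0), Num.max p.2 0 <= Num.max t0 0 + 1.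
    apply: (@continuous_snd X R (x0, t0) (fun s => Num.max s 0 <= Num.max t0 0 + 1)).
    apply: (cvgr_le _ (@max0_continuous R t0)); by rewrite ltrDl.
  have UEn p : Num.max p.2 0 <= Num.max t0 0 + 1 -> U p.1 p.2 = E p.1 (Num.max p.2 0) n.
    move=> pn; apply: Eindep => //; first by rewrite le_max lexx orbT.
    exact: le_trans pn (mP _).
  have cE : continuous (fun p : X * R => E p.1 (Num.max p.2 0) n xi).
    apply: (@unitaryX_continuous _ _ _ (fun p : X * R => L p.1 (Num.max p.2 0 / n.+1%:R))).
      by move=> p; exact: uL.
    move=> eta.
    apply: (continuous_compT (g := fun p : X * R => (p.1, Num.max p.2 0 / n.+1%:R)) (cL eta)).
    apply: continuous_pair; first exact: continuous_fst.
    move=> p; apply: cvgM; last exact: cvg_cst.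
    exact: (continuous_compT (@max0_continuous R) (@continuous_snd X R)).
  rewrite /continuous_at /= (UEn (x0, t0)) /= ?lerDl//.
  apply: cvg_trans (cE (x0, t0)); apply: near_eq_cvg.
  by near=> p; rewrite /= UEn//; near: p.
- pose n := m (s + t); have stn := mP (s + t); rewrite -/n in stn.
  have sn : s <= d *+ n.+1 by rewrite (le_trans _ stn)// lerDl.
  have tn : t <= d *+ n.+1 by rewrite (le_trans _ stn)// lerDr.
  rewrite (UE x s n)// (UE x t n)// (UE x (s + t) n)// ?addr_ge0//.
  have s'0 : 0 <= s / n.+1%:R by rewrite divr_ge0.
  have t'0 : 0 <= t / n.+1%:R by rewrite divr_ge0.
  have stn' := divd _ _ stn; rewrite mulrDl in stn'.
  (* The power of the product splits because [L] at the two short times commutes: both orders give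
     [L] at their sum. *)
  rewrite /E mulrDl LD// exprMn_comm// /GRing.comm.
  by rewrite -!LD// addrC.
- pose n := m t; have tn := mP t; rewrite -/n in tn; rewrite (UE x t n)//.
  pose u := t / n.+1%:R; have u0 : 0 <= u by rewrite divr_ge0.
  have ud : u <= d := divd _ _ tn.
  have tE : t = u *+ n.+1 by rewrite /u -mulr_natr divfK// pnatr_eq0.
  rewrite {1}tE /E -/u; elim: n.+1 => [|k IH]; first by rewrite mulr0n a0 mulr1 mul1r.
  rewrite mulrS aD// ?mulrn_wge0//= exprS mulrA LA ?u0// -!mulrA.
  by rewrite IH mulrA.
Unshelve. all: by end_near. Qed.

Lemma adjoint1 : (1 : bop H)^† = 1.
Proof. exact: adjointE. Qed.

Lemma unitary_group_extension (a : X -> R -> bop H -> bop H) (U : X -> R -> bop H) :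
  (forall x t, unitary (U x t)) ->
  (forall xi, continuous (fun p : X * R => U p.1 p.2 xi)) ->
  (forall x s t, 0 <= s -> 0 <= t -> U x (s + t) = U x s * U x t) ->
  (forall x t, 0 <= t -> forall A, a x t A * U x t = U x t * A) ->
  (forall x, a x 0 = id) -> (forall x s t, a x (s + t) = a x s \o a x t) ->
  exists W : X -> R -> bop H,
    [/\ forall x t, unitary (W x t),
        forall xi, continuous (fun p : X * R => W p.1 p.2 xi),
        forall x s t, W x (s + t) = W x s * W x t,
        forall x, W x 0 = 1 &
        forall x t A, a x t A * W x t = W x t * A].
Proof.
move=> uU cU UD UA a0 aD.
have U0 x : U x 0 = 1 by apply: unitary_idem1 => //; rewrite -UD ?addr0.
pose W x t := U x (Num.max t 0) * (U x (Num.max (- t) 0))^†.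
have W_ge0 x t : 0 <= t -> W x t = U x t.
  by move=> t0; rewrite /W max_l// max_r ?oppr_le0// U0 adjoint1 mulr1.
have W_le0 x t : t <= 0 -> W x t = (U x (- t))^†.
  by move=> t0; rewrite /W max_r// max_l ?oppr_ge0// U0 mul1r.
(* The value depends only on [p - q], so times may be written as any difference of nonnegative
   numbers and no case analysis on signs is needed for the group law. *)
have WB x p q : 0 <= p -> 0 <= q -> W x (p - q) = U x p * (U x q)^†.
  move=> p0 q0; have [pq|/ltW pq] := leP q p.
    have -> : U x p = U x (p - q) * U x q by rewrite -UD ?subr_ge0// subrK.
    by rewrite W_ge0 ?subr_ge0// -mulrA (uU x q).2 mulr1.
  have -> : U x q = U x (q - p) * U x p by rewrite -UD ?subr_ge0// subrK.
  by rewrite W_le0 ?subr_le0// opprB adjointM// mulrA (uU x p).2 mul1r.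
exists W; split=> [x t|xi|x s t|x|x t A].
- by apply: unitaryM => //; exact: unitary_adj.
- have c1 (h : R -> R) : continuous h -> forall eta,
      continuous (fun p : X * R => U p.1 (h p.2) eta).
    move=> hc eta; apply: (continuous_compT (g := fun p => (p.1, h p.2)) (cU eta)).
    apply: continuous_pair; first exact: continuous_fst.
    exact: (continuous_compT hc (@continuous_snd X R)).
  apply: (@unitary_comp_continuous _ _ _ (fun p : X * R => U p.1 (Num.max p.2 0))).
  + by move=> p; exact: uU.
  + exact: (c1 (fun t => Num.max t 0) (@max0_continuous R)).
  + apply: (@unitary_adjoint_continuous _ _ _ (fun p : X * R => U p.1 (Num.max (- p.2) 0))).
      by move=> p; exact: uU.
    apply: (c1 (fun t => Num.max (- t) 0)).
    exact: (continuous_compT (@max0_continuous R) (@oppr_continuous R R)).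
- have pm (r : R) : exists p q, [/\ 0 <= p, 0 <= q & r = p - q].
    exists (Num.max r 0), (Num.max (- r) 0).
    split; rewrite ?le_max ?lexx ?orbT//; have [r0|/ltW r0] := leP 0 r.
      by rewrite max_r ?oppr_le0// subr0.
    by rewrite max_l ?oppr_ge0// sub0r opprK.
  have [p [q [p0 q0 ->]]] := pm s; have [p' [q' [p'0 q'0 ->]]] := pm t.
  have -> : p - q + (p' - q') = (p + p') - (q' + q) by ring.
  rewrite !WB ?addr_ge0// !UD// adjointM// -!mulrA; congr (_ * _); rewrite !mulrA.
  congr (_ * _).
  (* What remains is that [U_p'] commutes with [U_q^†]; this follows from [U_p' U_q = U_q U_p'],
     both being [U] at the sum. *)
  rewrite -[RHS]mulr1 -(uU x q).2 !mulrA -[in RHS](mulrA _ (U x p')) -UD//.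
  by rewrite addrC UD// !mulrA (uU x q).1 mul1r.
- by rewrite W_ge0.
- have [t0|/ltW t0] := leP 0 t; first by rewrite W_ge0// UA.
  rewrite W_le0//; set V := U x (- t).
  (* For negative [t] the map [a x (- t)], implemented by [V], undoes [a x t]; hence [V^†]
     implements [a x t]. *)
  have AE : a x (- t) (a x t A) = A by rewrite -[LHS]/((a x (- t) \o a x t) A) -aD addNr a0.
  have := UA x (- t) _ (a x t A); rewrite AE oppr_ge0 => /(_ t0) E.
  have uV : unitary V by exact: uU.
  by rewrite -[LHS]mul1r -uV.1 !mulrA -(mulrA _ V) -E -!mulrA uV.2 mulr1.
Qed.

End global.

Lemma exists_unit_vector (R : realType) (H : hilbertType R) :
  infinite_dimensional H -> exists e : H, inner e e = 1.
Proof.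
(* A vector outside the span of the empty list is nonzero and can be normalised. *)
move=> /(_ [::])[v /(_ (fun=> 0))]; rewrite big_ord0 => v0.
exists (`|v|^-1 *: v); rewrite innerZl innerZr -sqr_norm_inner fmorphV/=.
have vn : `|v| != 0 by rewrite normr_eq0; exact/eqP.
by rewrite geC0_conj// expr2 mulrA mulrACA mulVf// mulr1.
Qed.

Lemma implements_conj (R : realType) (H : hilbertType R)
    (f : bop H -> bop H) (V : bop H) A :
  unitary V -> f A * V = V * A -> f A = V * A * V^†.
Proof. by move=> uV <-; rewrite -mulrA uV.2 mulr1. Qed.

(** * Trivialization *)

Section trivialization.
Context {R : realType} {H : hilbertType R} {X : topologicalType}.

Lemma val_continuous : continuous (val : Rplus R -> R).
Proof. exact: initial_continuous. Qed.

Lemma max0_Rplus (t : R) : Num.max t 0 \in Rplus R.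
Proof. by rewrite inE /Rplus /= le_max lexx orbT. Qed.

(** The retraction of the line onto the half line, used to extend a semigroup to negative times by
    its value at 0. *)
Definition posR (t : R) : Rplus R := SigSub (max0_Rplus t).

Lemma posR_continuous : continuous posR.
Proof.
apply: continuous_comp_initial.
exact: max0_continuous.
Qed.

Lemma E0_weakly_continuous_family (b : Rplus R -> bop H -> bop H) :
  E0_semigroup b -> (forall t, star_automorphism (b t)) ->
  weakly_continuous_family (fun (_ : X) t => b (posR t)).
Proof.
move=> [_ b0 bD bc] baut; split=> [_ t|_|_ s t s0 t0|A xi eta].
- exact: baut.
- rewrite -b0; congr b; apply: val_inj; by rewrite /= max_l.
- rewrite -bD; congr b; apply: val_inj; by rewrite /= !max_l ?addr_ge0.
- apply: sigma_weak_continuous_inner.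
  apply: (continuous_compT (bc A)).
  exact: (continuous_compT posR_continuous (@continuous_snd X R)).
Qed.

(** For [C_t = U_t W_t^†], one has [C_(t+s) = U_t U_s W_s^† W_t^† = C_t (W_t C_s W_t^†)], and
    conjugation by [W_t] is [b t]. *)
Lemma trivializable_of_implementers (alpha : X -> R -> bop H -> bop H)
    (b : Rplus R -> bop H -> bop H) (U W : X -> R -> bop H) :
  (forall x, E0_semigroup (fun t : Rplus R => alpha x (val t))) ->
  (forall x t, unitary (U x t)) ->
  (forall xi, continuous (fun p : X * R => U p.1 p.2 xi)) ->
  (forall x s t, 0 <= s -> 0 <= t -> U x (s + t) = U x s * U x t) ->
  (forall x t, 0 <= t -> forall A, alpha x t A * U x t = U x t * A) ->
  (forall x t, unitary (W x t)) ->
  (forall xi, continuous (fun p : X * R => W p.1 p.2 xi)) ->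
  (forall x s t, 0 <= s -> 0 <= t -> W x (s + t) = W x s * W x t) ->
  (forall x (t : Rplus R) A, b t A * W x (val t) = W x (val t) * A) ->
  trivializable (fun x t => alpha x (val t)) b.
Proof.
move=> E0 uU cU UD UA uW cW WD WA; split => //.
have ge0 (t : Rplus R) : 0 <= val t by exact: set_valP t.
pose C x t := U x t * (W x t)^†.
have uC x t : unitary (C x t) by apply: unitaryM => //; exact: unitary_adj.
have uC' x t : C x t \in @unitary_group R H by rewrite inE; exact: uC.
pose c (p : X * Rplus R) : @unitary_group R H := SigSub (uC' p.1 (val p.2)).
have cc : continuous c.
  apply: continuous_comp_initial.
  apply: strong_continuous => xi.
  have vc : continuous (fun p : X * Rplus R => (p.1, val p.2)).
    apply: continuous_pair; first exact: continuous_fst.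
    exact: (continuous_compT val_continuous (@continuous_snd X (Rplus R))).
  apply: (@unitary_comp_continuous _ _ _ (fun p : X * Rplus R => U p.1 (val p.2))).
  - by move=> p; exact: uU.
  - by move=> eta; exact: (continuous_compT (cU eta) vc).
  - apply: (@unitary_adjoint_continuous _ _ _ (fun p : X * Rplus R => W p.1 (val p.2))).
      by move=> p; exact: uW.
    by move=> eta; exact: (continuous_compT (cW eta) vc).
(* Currying a jointly continuous map gives both the continuity of each path and the continuity in
   [x] for the compact-open topology. *)
have [cc1 cc2] := continuous_curry cc.
have W0 x : W x 0 = 1 by apply: unitary_idem1 => //; rewrite -WD ?addr0.
have U0 x : U x 0 = 1 by apply: unitary_idem1 => //; rewrite -UD ?addr0.
exists (fun x => mkcts (cc2 x)); split.
- move=> x; split.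
    by rewrite -[LHS]/(U x 0 * (W x 0)^†) U0 W0 adjoint1 mulr1.
  move=> t s; rewrite -[LHS]/(U x (val t + val s) * (W x (val t + val s))^†).
  rewrite -[bop_of_unitary _ in RHS]/(U x (val t) * (W x (val t))^†).
  rewrite -[X in b t X]/(U x (val s) * (W x (val s))^†).
  rewrite (implements_conj (uW x (val t)) (WA x t _)) UD// WD// adjointM//.
  by rewrite -!mulrA; congr (_ * _); rewrite [RHS]mulrA (uW x _).1 mul1r.
- exact: continuous_comp_initial.
- move=> x t A; rewrite -[bop_of_unitary _]/(U x (val t) * (W x (val t))^†).
  rewrite (implements_conj (uW x (val t)) (WA x t _)).
  rewrite (adjointM (uU x (val t)) (unitary_adj (uW x (val t)))).
  rewrite (implements_conj (f := alpha x (val t)) (uU x (val t)))//; last exact: UA.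
  rewrite unitary_adjointK// -!mulrA.
  by rewrite !(mulrA (W x (val t))^† (W x (val t))) (uW x _).1 !mul1r.
Qed.

End trivialization.

Unset Implicit Arguments.

Theorem theorem2p5 (R : realType) (H : hilbertType R)
  (H_separable : separable H) (H_infinite : infinite_dimensional H)
  (X : topologicalType)
  (X_compact : compact [set: X]) (X_hausdorff : hausdorff_space X)
  (alpha : X -> R -> bop H -> bop H)
  (alpha_group : forall x, star_automorphism_group (alpha x))
  (alpha_continuous : forall A : bop H,
    continuous (fun p : X * R => alpha p.1 p.2 A : sigma_weak_bop H)) :
  (exists U : X -> R -> bop H,
    [/\ forall x t, unitary (U x t),
        continuous (fun p : X * R => U p.1 p.2 : strong_bop H),
        forall x, U x 0 = 1 /\ forall t s, U x (t + s) = U x t * U x s &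
        forall x t A, alpha x t A = U x t * A * (U x t)^†]) /\
  (forall beta : Rplus R -> bop H -> bop H,
    E0_semigroup beta -> (forall t, star_automorphism (beta t)) ->
    trivializable (fun x t => alpha x (val t)) beta).
Proof.
have [e ee] := exists_unit_vector H_infinite.
have fam : weakly_continuous_family alpha.
  split=> [x t|x|x s t _ _|A xi eta].
  - by have [] := alpha_group x.
  - by have [] := alpha_group x.
  - by have [_ _ ->] := alpha_group x.
  - exact: sigma_weak_continuous_inner.
have [U [uU cU UD UA]] := unitary_semigroup X_compact fam ee.
split.
  have [| |W [uW cW WD W0 WA]] := unitary_group_extension uU cU UD UA.
  - by move=> x; have [] := alpha_group x.
  - by move=> x s t; have [_ _ ->] := alpha_group x.
  exists W; split => //; first exact: strong_continuous.
  by move=> x t A; exact: implements_conj.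
move=> b E0b baut.
(* The reference semigroup is treated as a family over the same [X], constant in [x], so the
   construction used for [alpha] provides its implementers. *)
have bfam : weakly_continuous_family (fun (_ : X) t => b (posR t)).
  exact: E0_weakly_continuous_family.
have [W [uW cW WD WA]] := unitary_semigroup X_compact bfam ee.
apply: (trivializable_of_implementers _ uU cU UD UA uW cW WD).
- move=> x; have [aut a0 aD] := alpha_group x; split => //.
  + by move=> t; have [] := aut (val t).
  + by move=> t s; rewrite -aD.
  + move=> A; apply: (continuous_compT (g := fun t : Rplus R => (x, val t)) (alpha_continuous A)).
    by apply: continuous_pair; [exact: cst_continuous|exact: val_continuous].
- move=> x t A; have t0 : 0 <= val t by exact: set_valP t.
  have := WA x (val t) t0 A; have -> // : posR (val t) = t.
  by apply: val_inj; rewrite /= max_l.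
Qed.
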